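(* For $k\in\mathbb{N}$ define $\alpha_k$ and $\beta_k$ by $$\tau_{k+5,k}=\frac{1}{2k+1}\Big(\frac{4}{k+4}\Big)^{3/2}\alpha_k,\qquad \tau_{k+6,k}=\frac{1}{2k+1}\Big(\frac{5}{k+5}\Big)^{2}\beta_k .$$ Then $\tau_{n,k}\le\tau_{k+5,k}$ for $n\ge k+5$ and $\tau_{n,k}\le \tau_{k+6,k}$ for $n\ge k+6$; moreover the sequences $(\alpha_k)$ and $(\beta_k)$ are strictly increasing in $k$ and converge to $$\alpha_*=\frac{\sqrt{3(3+\sqrt6)}}{4}=1.0108\ldots,\qquad \beta_*=\frac{2+\sqrt{10}}{5}=1.0325\ldots,$$ respectively, with $\alpha_k<\alpha_*$ and $\beta_k<\beta_*$ for all $k$.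
   Context: $T_n$ denotes the Chebyshev polynomial of the first kind of degree $n$, $T_n(\cos\theta)=\cos n\theta$. For integers $n\ge k+2$, $k\ge 1$, let $\omega_{n,k}$ be the rightmost (largest) zero of $T_n^{(k+1)}$ and define $\tau_{n,k}:=|T_n^{(k)}(\omega_{n,k})|/T_n^{(k)}(1)$. *)

(* Defs.v *)
From HB Require Import structures.
From mathcomp Require Import all_boot all_order all_algebra.
From mathcomp Require Import all_classical all_reals all_analysis.
Set Implicit Arguments. Unset Strict Implicit. Unset Printing Implicit Defensive.
Import Order.TTheory GRing.Theory Num.Theory.
Import numFieldNormedType.Exports.
Local Open Scope classical_set_scope.
Local Open Scope ring_scope.

(* Chebyshev polynomials of the first kind, via T_0 = 1, T_1 = X,
   T_{n+2} = 2 X T_{n+1} - T_n  (so that T_n(cos t) = cos (n t)). *)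
Fixpoint cheb_pair (R : nzRingType) (n : nat) : {poly R} * {poly R} :=
  match n with
  | 0 => (1, 'X)
  | m.+1 => let p := cheb_pair R m in (p.2, 2%:R *: 'X * p.2 - p.1)
  end.

Definition cheb (R : nzRingType) (n : nat) : {poly R} := (cheb_pair R n).1.

Definition omega (R : realType) (n k : nat) : R :=
  sup [set x : R | root ((cheb R n)^`(k.+1)) x].

Definition tau (R : realType) (n k : nat) : R :=
  `|((cheb R n)^`(k)).[omega R n k]| / ((cheb R n)^`(k)).[1].

Definition alpha (R : realType) (k : nat) : R :=
  tau R (k + 5) k * (2 * k%:R + 1) /
    ((4 / (k%:R + 4)) * Num.sqrt (4 / (k%:R + 4))).

Definition beta (R : realType) (k : nat) : R :=
  tau R (k + 6) k * (2 * k%:R + 1) / ((5 / (k%:R + 5)) ^+ 2).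

Definition alpha_star (R : realType) : R :=
  Num.sqrt (3 * (3 + Num.sqrt 6)) / 4.

Definition beta_star (R : realType) : R := (2 + Num.sqrt 10) / 5.

(* Main.v *)
Require Import Defs.
From HB Require Import structures.
From mathcomp Require Import all_boot all_order all_algebra.
From mathcomp Require Import all_classical all_reals all_analysis.
From mathcomp Require Import ring lra polyrcf.
Import Order.TTheory GRing.Theory Num.Theory.
Import numFieldNormedType.Exports.
Local Open Scope classical_set_scope.
Local Open Scope ring_scope.

(* Put u = T_n^(k), v = T_{n+1}^(k) and c = u(1)/v(1). The Sonin-type polynomial
   Q = u^2 + (1 - x^2) (u'/(n+k))^2 satisfies Q' = const * u' v' with a nonnegative
   constant, and it takes the value u^2 at critical points of u and (c v)^2 at
   critical points of v. Between the rightmost critical point of u and that of v one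
   has u' >= 0 >= v', so Q decreases there, which gives tau_{n+1,k} <= tau_{n,k}.

   For n - k = 5 and 6 the rightmost critical point is found by solving a quadratic
   equation in x^2. Writing its discriminant through r = sqrt (6 - 3/(k+3)), resp.
   r = sqrt (10 - 15/(k+4)), makes k itself rational in r, and then
   alpha_k^2 = (3+r)^3 / (8 (2+r)^2), resp. beta_k = 2 (5+r)^2 / (25 (2+r)). Both
   expressions are increasing in r, and r increases to sqrt 6, resp. sqrt 10. *)

(** * Ladder relations and differential equation for the derivatives of T_n *)

Section Algebra.
Context {R : realType}.
Implicit Types (n k j : nat) (x : R).

Local Notation T := (cheb R).

Lemma cheb0 : T 0 = 1. Proof. by []. Qed.

Lemma cheb1 : T 1 = 'X. Proof. by []. Qed.

Lemma chebSS n : T n.+2 = 'X * T n.+1 *+ 2 - T n.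
Proof. by rewrite [T n.+2]/cheb /= -/(T n) scaler_nat mulrnAl. Qed.

(* [cheb2 n] is the Chebyshev polynomial of the second kind of degree [n - 1]. *)
Fixpoint cheb2 n : {poly R} := if n is m.+1 then 'X * cheb2 m + T m else 0.

(** With x = cos t, [cheb2 n] is sin(nt)/sin t, and this is the addition formula for cos((n+1)t). *)
Lemma cheb_cheb2 n : T n.+1 = 'X * T n - (1 - 'X^2) * cheb2 n.
Proof.
elim: n => [|n IH]; first by rewrite cheb0 cheb1 /=; ring.
by rewrite chebSS /= IH; ring.
Qed.

Lemma cheb2_pred n : cheb2 n = 'X * cheb2 n.+1 - T n.+1.
Proof. by rewrite /= cheb_cheb2; ring. Qed.

Lemma deriv_cheb n : (T n)^`() = n%:R * cheb2 n.
Proof.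
have [] // : (T n)^`() = n%:R * cheb2 n /\ (T n.+1)^`() = n.+1%:R * cheb2 n.+1.
elim: n => [|n [IH0 IH1]]; first by rewrite cheb0 cheb1 /= derivX derivC cheb0; split; ring.
split=> //; rewrite chebSS derivB derivMn derivM derivX IH0 IH1.
have -> : cheb2 n.+2 = 'X * cheb2 n.+1 + T n.+1 by [].
by rewrite (cheb2_pred n); ring.
Qed.

Lemma deriv_natM n (p : {poly R}) : (n%:R * p)^`() = n%:R * p^`().
Proof. by rewrite !mulr_natl derivMn. Qed.

(** For k = 0 this is the recursion of [cheb2]. Each differentiation of the product with 'X releases
    one more derivative, which turns n into n + k; in the lowering relation below, the same effect
    turns n + 1 into n + 1 - k. *)
Lemma cheb_derivn_up n k :
  n%:R * (T n.+1)^`(k.+1) = n.+1%:R * ('X * (T n)^`(k.+1) + (n + k)%:R * (T n)^`(k)).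
Proof.
elim: k => [|k /(congr1 (@deriv R))].
  by rewrite !derivn1 !deriv_cheb /= ?derivn0; ring.
rewrite !deriv_natM derivD derivM deriv_natM -!derivnS derivX.
by move->; ring.
Qed.

Lemma cheb_derivn_down n k :
  n.+1%:R * (T n)^`(k.+1) =
  n%:R * ('X * (T n.+1)^`(k.+1) - (n.+1%:R - k%:R) * (T n.+1)^`(k)).
Proof.
elim: k => [|k /(congr1 (@deriv R))].
  by rewrite !derivn1 !deriv_cheb /= ?derivn0 cheb_cheb2; ring.
rewrite mulrBl !(deriv_natM, derivB) derivM -!derivnS derivX.
by move->; ring.
Qed.

Local Notation D n k x := ((T n)^`(k)).[x].

Lemma cheb_derivn_upE n k x :
  n%:R * D n.+1 k.+1 x = n.+1%:R * (x * D n k.+1 x + (n + k)%:R * D n k x).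
Proof.
by have /(congr1 (horner^~ x)) := cheb_derivn_up n k; rewrite !(hornerE, hornerMn).
Qed.

Lemma cheb_derivn_downE n k x :
  n.+1%:R * D n k.+1 x =
  n%:R * (x * D n.+1 k.+1 x - (n.+1%:R - k%:R) * D n.+1 k x).
Proof.
by have /(congr1 (horner^~ x)) := cheb_derivn_down n k; rewrite !(hornerE, hornerMn).
Qed.

(** Lowering after raising: T_{n+1} is eliminated between the raising relation at k and k + 1 and
    the lowering relation at k + 1. *)
Lemma cheb_derivn_ode n k x :
  (1 - x ^+ 2) * D n k.+2 x =
  (k.*2.+1)%:R * (x * D n k.+1 x) - (n%:R - k%:R) * (n%:R + k%:R) * D n k x.
Proof.
case: n => [|n].
  suff D0 j : D 0 j.+1 x = 0.
    rewrite !D0; case: k => [|k]; last by rewrite D0; ring.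
    by rewrite /= cheb0 hornerE; ring.
  by rewrite cheb0 derivnC hornerE.
have n0 : n.+1%:R != 0 :> R by rewrite pnatr_eq0.
have n1 : n.+2%:R != 0 :> R by rewrite pnatr_eq0.
have E1 := cheb_derivn_upE n.+1 k x; have E2 := cheb_derivn_upE n.+1 k.+1 x.
have E3 := cheb_derivn_downE n.+1 k.+1 x.
apply: (mulfI n1).
rewrite mulrBl mul1r mulrBr E3 mulrBr [_ * (x * D n.+2 _ _)]mulrCA E2.
rewrite [n.+1%:R * (_ * D n.+2 _ _)]mulrCA E1 -muln2.
ring.
Qed.

(** The two ladder relations form a linear system for the derivatives of T_n^(k) and T_{n+1}^(k)
    with determinant 1 - x^2. This lemma and the next one solve it. *)
Lemma cheb_derivn_next n k x :
  n.+1%:R * ((1 - x ^+ 2) * D n k.+1 x) =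
  n.+1%:R * (n + k)%:R * (x * D n k x) - n%:R * (n.+1%:R - k%:R) * D n.+1 k x.
Proof.
have E1 := cheb_derivn_upE n k x; have E2 := cheb_derivn_downE n k x.
rewrite mulrBl mul1r mulrBr E2 mulrBr [_ * (x * D n.+1 _ _)]mulrCA E1; ring.
Qed.

Lemma cheb_derivn_prev n k x :
  n%:R * ((1 - x ^+ 2) * D n.+1 k.+1 x) =
  n.+1%:R * (n + k)%:R * D n k x - n%:R * (n.+1%:R - k%:R) * (x * D n.+1 k x).
Proof.
have E1 := cheb_derivn_upE n k x; have E2 := cheb_derivn_downE n k x.
rewrite mulrBl mul1r mulrBr E1 mulrDr [_ * (x * D n _ _)]mulrCA E2; ring.
Qed.

Lemma cheb_derivn_diag_gt0 n : {c : R | 0 < c & (T n)^`(n) = c%:P}.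
Proof.
elim: n => [|n [c c0 cE]]; first by exists 1.
case: n => [|n] in c c0 cE *; first by exists 1 => //; rewrite cheb1 derivn1 derivX.
exists (n.+2%:R / n.+1%:R * (n.+1 + n.+1)%:R * c).
  by rewrite !mulr_gt0 ?invr_gt0 ?ltr0n.
have n0 : n.+1%:R != 0 :> R by rewrite pnatr_eq0.
have n0' : n.+1%:R != 0 :> {poly R} by rewrite -polyC_natr polyC_eq0.
apply: (mulfI n0'); rewrite cheb_derivn_up derivnS cE derivC -!polyC_natr.
by rewrite mulr0 add0r -!polyCM; congr (_%:P); field.
Qed.

Lemma cheb_derivn_gt_diag n : (T n)^`(n.+1) = 0.
Proof. by rewrite derivnS; have [c _ ->] := cheb_derivn_diag_gt0 n; rewrite derivC. Qed.

(** By the ladder relations a common zero at degree n + 1 is also one at degree n. The descent ends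
    on the diagonal, where T_k^(k) is a positive constant. *)
Lemma cheb_derivn_no_double_root n k x :
  (k <= n)%N -> D n k x = 0 -> D n k.+1 x = 0 -> False.
Proof.
elim: n => [|n IH].
  by rewrite leqn0 => /eqP ->; rewrite cheb0 hornerE => /eqP; rewrite oner_eq0.
rewrite leq_eqVlt => /predU1P[-> |]; last first.
  rewrite ltnS => kn V0 V1; apply: (IH kn).
    have n1k : n.+1%:R * (n + k)%:R * D n k x = 0.
      by have := cheb_derivn_prev n k x; rewrite V0 V1 !mulr0 subr0.
    move/eqP: n1k; rewrite !mulf_eq0 !pnatr_eq0 /= addn_eq0.
    case/orP=> [/andP[/eqP n0 /eqP k0] | /eqP //]; move: V1.
    by rewrite n0 k0 cheb1 derivn1 derivX hornerE => /eqP; rewrite oner_eq0.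
  have := cheb_derivn_downE n k x; rewrite V0 V1 !mulr0 subr0 mulr0 => /eqP.
  by rewrite mulf_eq0 pnatr_eq0 /= => /eqP.
have [c c0 ->] := cheb_derivn_diag_gt0 n.+1; rewrite hornerC => c00.
by rewrite c00 ltxx in c0.
Qed.

Lemma cheb_gt0 n x : 1 <= x -> 0 < D n 0 x.
Proof.
(* For x >= 1 the three-term recurrence preserves monotonicity in n, and monotonicity in turn keeps
   the values positive. *)
move=> x1; suff [] : 0 < D n 0 x /\ D n 0 x <= D n.+1 0 x by [].
elim: n => [|n [IH1 IH2]]; first by rewrite /= cheb0 cheb1 !hornerE; split.
split; first exact: lt_le_trans IH2.
by move: IH1 IH2; rewrite /= chebSS !(hornerE, hornerMn); nra.
Qed.

Lemma cheb_derivn_gt0 n k x : 1 <= x -> (k <= n)%N -> 0 < D n k x.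
Proof.
move=> x1; have x0 : 0 <= x by lra.
elim: n k => [|n IH] [|k] //; try by move=> _; exact: cheb_gt0.
case: n IH => [|n] IH; rewrite ltnS => kn.
  by move: kn; rewrite leqn0 => /eqP ->; rewrite cheb1 derivn1 derivX hornerE.
have n0 : 0 < n.+1%:R :> R by rewrite ltr0n.
rewrite -(pmulr_rgt0 _ n0) cheb_derivn_upE mulr_gt0 ?ltr0n //.
apply: ltr_wpDl; last by rewrite mulr_gt0 ?ltr0n ?addSn // IH.
rewrite mulr_ge0 //; case: (ltnP n.+1 k.+1) => kn1; last by rewrite ltW ?IH.
have -> : k = n.+1 by apply/eqP; rewrite eqn_leq kn -ltnS.
by rewrite cheb_derivn_gt_diag hornerE.
Qed.

End Algebra.

(** * Signs of polynomials and of their derivatives next to a zero *)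

Section PolySigns.
Context {R : rcfType}.
Implicit Types (p : {poly R}) (a b x y z : R).

(** Otherwise p would fall strictly below p(z) = 0 up to the next zero of its derivative. *)
Lemma deriv_ge0_right p z y : z < y -> p.[z] = 0 ->
  (forall x, z < x < y -> 0 <= p.[x]) -> 0 <= p^`().[z].
Proof.
move=> zy pz pos; rewrite leNgt; apply/negP => dneg.
have d0 : p^`() != 0 by apply: contraTneq dneg => ->; rewrite hornerC ltxx.
have zt := next_root_gt zy d0; set t := next_root _ _ _ in zt.
(* [next_root] defaults to the end y when the derivative has no zero in between, so the bound holds
   in either case. *)
have ty : t <= y.
  by have := next_root_in p^`() z y; rewrite (max_l (ltW zy)) => /itvP ->.
have dneg' x : x \in `]z, t[ -> p^`().[x] < 0.
  move=> xzt; rewrite -sgr_cp0.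
  by rewrite (sgr_neighprN (ltr0_neq0 dneg) xzt) sgr_cp0.
have [zm mt] := midf_lt zt.
have mzt : (z + t) / 2 \in `]z, t] by rewrite in_itv /= zm ltW.
by have := dernr dneg' mzt; rewrite pz ltNge pos // zm (lt_le_trans mt ty).
Qed.

Lemma deriv_le0_left p y z : y < z -> p.[z] = 0 ->
  (forall x, y < x < z -> 0 <= p.[x]) -> p^`().[z] <= 0.
Proof.
move=> yz pz pos.
have := @deriv_ge0_right (p \Po - 'X) (- z) (- y).
rewrite ltrN2 deriv_comp derivN derivX !(horner_comp, hornerE) opprK.
rewrite mulrN1 oppr_ge0; apply=> // x /andP[zx xy].
by rewrite horner_comp !hornerE; apply: pos; rewrite ltrNr xy ltrNl zx.
Qed.

(** The intermediate value theorem provides a zero in ]a, b[; after the last such zero p keeps the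
    sign of p(b). *)
Lemma last_root_ex p a b : a < b -> p.[a] < 0 -> (forall x, b <= x -> 0 < p.[x]) ->
  exists z, [/\ a < z < b, p.[z] = 0 & forall x, z < x -> 0 < p.[x]].
Proof.
move=> ab pa pb; have p0 : p != 0 by apply: contraTneq pa => ->; rewrite hornerC ltxx.
have [||z] := @poly_ivtoo _ p a b; rewrite ?ltW //.
  by rewrite nmulr_rlt0 ?pb.
move=> zab pz; have := prev_rootP p a b.
case=> [/eqP|y _ py yab nr|c _ _ nr]; first by rewrite (negPf p0).
  exists y; split=> //.
  move=> x yx; case: (ltP x b) => xb; last exact: pb.
  have sx : {in `[x, b], forall t, ~~ root p t}.
    move=> t; rewrite in_itv /= => /andP[xt]; rewrite le_eqVlt => /predU1P[->|tb].
      by rewrite rootE gt_eqF ?pb.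
    by apply: nr; rewrite in_itv /= (lt_le_trans yx xt).
  have := polyrN0_itv sx (x := x) (y := b); rewrite !bound_in_itv !bnd_simp (ltW xb).
  move=> /(_ isT isT) sE; rewrite -sgr_gt0 -sE sgr_gt0; exact: pb.
by have := nr _ zab; rewrite pz.
Qed.

Lemma next_root_ex p a b : a < b -> 0 < p.[a] -> p.[b] = 0 ->
  exists z, [/\ a < z <= b, p.[z] = 0 & p^`().[z] <= 0].
Proof.
move=> ab pa pb; have p0 : p != 0 by apply: contraTneq pa => ->; rewrite hornerC ltxx.
have pbr : root p b by apply/eqP.
(* The search runs up to b + 1 so that b, itself a candidate, lies inside the open interval. *)
have := next_rootP p a (b + 1).
case=> [/eqP|y _ py yab nr|c _ _ nr]; first by rewrite (negPf p0).
  exists y; have ay : a < y by rewrite (itvP yab).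
  split=> //.
    rewrite ay leNgt; apply/negP => yb.
    by have := nr b; rewrite in_itv /= ab yb => /(_ isT); rewrite pbr.
  apply: (deriv_le0_left _ _ _ ay py) => x /andP[ax xy].
  have sx : {in `[a, x], forall t, ~~ root p t}.
    move=> t; rewrite in_itv /= => /andP[]; rewrite le_eqVlt => /predU1P[<- _|ta tx].
      by rewrite rootE gt_eqF ?pa.
    by apply: nr; rewrite in_itv /= ta (le_lt_trans tx xy).
  have := polyrN0_itv sx (x := x) (y := a); rewrite !bound_in_itv !bnd_simp (ltW ax).
  move=> /(_ isT isT) sE; rewrite -sgr_ge0 -sE sgr_ge0; exact: ltW.
have := nr b; rewrite in_itv /= ab ltrDl ltr01 => /(_ isT); by rewrite pbr.
Qed.

End PolySigns.

(** * The rightmost critical point, by induction on the degree *)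

Section LastCriticalPoint.
Context {R : realType}.
Implicit Types (n k j : nat) (x w : R).

Local Notation T := (cheb R).
Local Notation D n k x := ((T n)^`(k)).[x].

(** A pointwise substitute for the supremum in [omega] that can be carried from n to n + 1; the
    bounds make 1 - w^2 positive. *)
Definition last_crit n k w :=
  [/\ 0 <= w < 1, D n k.+1 w = 0 & forall x, w < x -> 0 < D n k.+1 x].

Lemma omegaE n k w : D n k.+1 w = 0 -> (forall x, w < x -> 0 < D n k.+1 x) ->
  omega R n k = w.
Proof.
move=> w0 wpos; rewrite /omega.
have ubw : ubound [set x : R | root (T n)^`(k.+1) x] w.
  move=> x /= /eqP x0; rewrite leNgt; apply/negP => /wpos; by rewrite x0 ltxx.
have Sw : [set x : R | root (T n)^`(k.+1) x] w by apply/eqP.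
apply/eqP; rewrite eq_le; apply/andP; split.
  by apply: ge_sup => //; exists w.
by apply: ub_le_sup => //; exists w.
Qed.

(** At w the differential equation reads (1 - w^2) u'' = -(n^2 - k^2) u, and u'' >= 0 because u' is
    positive to the right of w. Equality is excluded since u and u' have no common zero. *)
Lemma last_crit_lt0 n k w : (k < n)%N -> last_crit n k w -> D n k w < 0.
Proof.
move=> kn [/andP[w0 w1] u1 pos].
have u2 : 0 <= D n k.+2 w.
  by apply: (deriv_ge0_right _ _ _ w1) => // x /andP[wx _]; apply/ltW/pos.
have kn' : k%:R < n%:R :> R by rewrite ltr_nat.
have k0 : 0 <= k%:R :> R by rewrite ler0n.
have := cheb_derivn_ode n k w; rewrite u1 mulr0 mulr0 sub0r => ode.
rewrite lt_neqAle; apply/andP; split.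
  by apply/eqP => u0; apply: (cheb_derivn_no_double_root _ _ _ (ltnW kn) u0 u1).
have nk : 0 < (n%:R - k%:R) * (n%:R + k%:R) :> R by apply: mulr_gt0; lra.
rewrite -(pmulr_rle0 _ nk) -oppr_ge0 -mulNr mulNr -ode mulr_ge0 //; nra.
Qed.

Lemma last_crit_deriv_next_lt0 n k w : (k < n)%N -> last_crit n k w ->
  D n.+1 k.+1 w < 0.
Proof.
move=> kn lc; have := last_crit_lt0 _ _ _ kn lc; case: lc => _ u1 _ u0.
have n0 : 0 < n%:R :> R by rewrite ltr0n; case: n kn {u0 u1}.
rewrite -(pmulr_rlt0 _ n0) cheb_derivn_upE u1 mulr0 add0r.
by rewrite !pmulr_rlt0 ?ltr0n // addn_gt0 -(ltr0n R) n0.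
Qed.

(** The derivative of T_{n+1}^(k) is negative at w and positive from 1 on, so its last zero lies in
    ]w, 1[. *)
Lemma last_crit_next n k w : (k < n)%N -> last_crit n k w ->
  exists2 w', w < w' & last_crit n.+1 k w'.
Proof.
move=> kn lc; have v0 := last_crit_deriv_next_lt0 _ _ _ kn lc.
case: lc => /andP[w0 w1] _ _.
have [|w' [/andP[ww' w'1] v1 pos]] := last_root_ex _ _ _ w1 v0.
  by move=> x x1; apply: cheb_derivn_gt0 => //; apply: ltnW.
by exists w' => //; split=> //; rewrite w'1 (le_trans w0 (ltW ww')).
Qed.

(** T_{k+2}^(k+1) is a positive multiple of x; this starts the induction on n. *)
Lemma last_crit_base k : last_crit k.+2 k 0.
Proof.
have [c c0 cE] := @cheb_derivn_diag_gt0 R k.+2.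
have E x : D k.+2 k.+1 x = x * c.
  have := cheb_derivn_downE k.+1 k.+1 x; rewrite cheb_derivn_gt_diag cE !hornerC mulr0.
  move=> /esym/eqP; rewrite mulf_eq0 pnatr_eq0 /= => /eqP; lra.
split; rewrite ?lexx ?ltr01 // ?E ?mul0r // => x x0; by rewrite E mulr_gt0.
Qed.

Lemma last_crit_ex n k : (k.+2 <= n)%N -> exists w, last_crit n k w.
Proof.
move=> /subnK <-; elim: (n - k.+2)%N => [|m [w lc]].
  by exists 0; apply: last_crit_base.
have [|w' _ lc'] := last_crit_next _ _ _ _ lc; last by exists w'.
by rewrite !addnS ltnS leqW ?leq_addl.
Qed.

(* Every zero of T_{n+1}^(k+1) in ]w, 1[ is a strict upcrossing, because there
   T_{n+1}^(k+2) is a positive multiple of T_n^(k+1). *)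
Lemma last_crit_deriv_next_le0 n k w w' x : (0 < n)%N ->
  last_crit n k w -> last_crit n.+1 k w' -> w < x < w' -> D n.+1 k.+1 x <= 0.
Proof.
move=> n0 [/andP[w0 _] _ upos] [/andP[_ w'1] v1 _] /andP[wx xw'].
rewrite leNgt; apply/negP => vx.
have [z [/andP[xz zw'] vz dvz]] := next_root_ex _ _ _ xw' vx v1.
have := cheb_derivn_prev n k.+1 z; rewrite vz !mulr0 subr0.
apply/eqP; rewrite lt_eqF //; apply: (@le_lt_trans _ _ 0).
  rewrite mulr_ge0_le0 ?ler0n // mulr_ge0_le0 //; nra.
by rewrite !mulr_gt0 ?ltr0n ?addn_gt0 ?n0 // upos // (lt_trans wx).
Qed.

End LastCriticalPoint.

(** * Monotonicity of [tau] in the degree *)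

Section Monotonicity.
Context {R : realType}.
Implicit Types (n k j : nat) (x w : R).

Local Notation T := (cheb R).
Local Notation D n k x := ((T n)^`(k)).[x].

(** The weight 1/(n^2 - k^2) would cancel the u u' term of the derivative; with (n+k)^-2 that term
    survives and combines with the rest into a multiple of u' v'. *)
Definition sonin n k : {poly R} :=
  (T n)^`(k) * (T n)^`(k) +
  ((n + k)%:R ^- 2)%:P * ((1%:P - 'X^2) * ((T n)^`(k.+1) * (T n)^`(k.+1))).

Lemma soninE n k x :
  (sonin n k).[x] = D n k x ^+ 2 + (1 - x ^+ 2) * (D n k.+1 x / (n + k)%:R) ^+ 2.
Proof. by rewrite !(hornerD, hornerM, hornerC, hornerN, hornerX) -exprVn; ring. Qed.

(** The differential equation gives 4k/(n+k)^2 u' ((n+k) u + x u'), and by the raising relation the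
    bracket is n/(n+1) v'. *)
Lemma deriv_soninE n k x : (0 < n)%N ->
  (sonin n k)^`().[x] =
  4 * k%:R * n%:R / (n.+1%:R * (n + k)%:R ^+ 2) * (D n k.+1 x * D n.+1 k.+1 x).
Proof.
move=> n0; rewrite derivD !derivM !derivB !derivC derivXn -!derivnS.
rewrite !(hornerD, hornerM, hornerC, hornerN, hornerMn, hornerX) /=.
have nk : (n + k)%:R != 0 :> R by rewrite pnatr_eq0 -lt0n addn_gt0 n0.
have n1 : n.+1%:R != 0 :> R by rewrite pnatr_eq0.
have Eup := cheb_derivn_upE n k x.
have Eode := cheb_derivn_ode n k x.
have -> : 4 * k%:R * n%:R / (n.+1%:R * (n + k)%:R ^+ 2) * (D n k.+1 x * D n.+1 k.+1 x)
  = 4 * k%:R / (n.+1%:R * (n + k)%:R ^+ 2) * (D n k.+1 x * (n%:R * D n.+1 k.+1 x)).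
  by ring.
rewrite Eup.
set U := D n k x in Eode *; set U1 := D n k.+1 x in Eode *; set U2 := D n k.+2 x in Eode *.
transitivity (2 * U * U1 + (n + k)%:R ^- 2 * (2 * ((1 - x ^+ 2) * U2) * U1 - 2 * x * U1 ^+ 2)).
  by ring.
rewrite Eode -muln2 natrD.
by field; rewrite -natrD nk nat1r n1.
Qed.

Lemma tau_next_le n k : (k.+2 <= n)%N -> tau R n.+1 k <= tau R n k.
Proof.
move=> kn; have kn' : (k < n)%N := ltnW kn.
have n0 : (0 < n)%N by case: n kn {kn'}.
have [w lc] := @last_crit_ex R _ _ kn.
have [w' ww' lc'] := last_crit_next _ _ _ kn' lc.
have vle0 x := last_crit_deriv_next_le0 _ _ _ _ x n0 lc lc'.
case: lc => _ u1 upos; case: lc' => /andP[w'0 w'1] v1 vpos.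
rewrite /tau (omegaE _ _ _ u1 upos) (omegaE _ _ _ v1 vpos).
have Nn : n.+1%:R != 0 :> R by rewrite pnatr_eq0.
have nR : 0 < n%:R :> R by rewrite ltr0n.
have kR : 0 <= k%:R :> R by rewrite ler0n.
have nkR : k%:R < n%:R :> R by rewrite ltr_nat.
have nk0 : 0 < (n + k)%:R :> R by rewrite ltr0n addn_gt0 n0.
(* This is u(1)/v(1), read off from [cheb_derivn_next] at x = 1, where the factor 1 - x^2
   vanishes. *)
pose c : R := n%:R * (n.+1%:R - k%:R) / (n.+1%:R * (n + k)%:R).
have c0 : 0 < c.
  apply: divr_gt0; apply: mulr_gt0; rewrite ?ltr0n ?addn_gt0 ?n0 //.
  by rewrite -[n.+1]addn1 natrD; lra.
have cE (y : R) : n%:R * (n.+1%:R - k%:R) * y = n.+1%:R * (n + k)%:R * (c * y).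
  by rewrite /c; field; rewrite -natrD nat1r Nn gt_eqF.
have N0 : n.+1%:R * (n + k)%:R != 0 :> R by rewrite mulf_neq0 ?gt_eqF.
have V1 : 0 < D n.+1 k 1 by apply: cheb_derivn_gt0 => //; apply/ltnW/ltnW.
have U1E : D n k 1 = c * D n.+1 k 1.
  have := cheb_derivn_next n k (1 : R).
  rewrite expr1n subrr mul0r mulr0 mul1r cE -mulrBr.
  by move=> /esym/eqP; rewrite mulf_eq0 (negPf N0) subr_eq0 => /eqP.
set V := D n.+1 k w'.
(* Since v' vanishes at w', both u and u' there are multiples of V, and Q(w') = (cV)^2 (w'^2 + 1 -
   w'^2). *)
have Uw' : D n k w' = w' * (c * V).
  have := cheb_derivn_prev n k w'; rewrite v1 !mulr0 cE -mulrBr.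
  move=> /esym/eqP; rewrite mulf_eq0 (negPf N0) subr_eq0 => /eqP ->.
  by rewrite /V; ring.
have U1w' : D n k.+1 w' = - ((n + k)%:R * (c * V)).
  have := cheb_derivn_next n k w'; rewrite -/V cE Uw' => E.
  have w2 : n.+1%:R * (1 - w' ^+ 2) != 0 by rewrite mulf_neq0 // subr_eq0 eq_sym lt_eqF // exprn_ilt1.
  by apply: (mulfI w2); rewrite -mulrA E; ring.
have Qle : (sonin n k).[w'] <= (sonin n k).[w].
  rewrite -lerN2 -!hornerN; apply: (@ler_hornerW _ w w' (- sonin n k)).
  - move=> x; rewrite in_itv /= => xw; have /andP[wx _] := xw.
    rewrite derivN hornerN oppr_ge0 deriv_soninE //; apply: mulr_ge0_le0.
      by rewrite divr_ge0 // ?mulr_ge0 ?exprn_ge0 ?ler0n.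
    by apply: mulr_ge0_le0; [apply/ltW/upos | exact: vle0].
  - by rewrite bound_in_itv bnd_simp ltW.
  - by rewrite bound_in_itv bnd_simp ltW.
  - exact: ltW.
have {Qle} cV : (c * V) ^+ 2 <= D n k w ^+ 2.
  move: Qle; rewrite !soninE u1 U1w' Uw' mul0r expr0n mulr0 addr0.
  rewrite [(- _ / _)](_ : _ = - (c * V)); last first.
    by field; rewrite -natrD gt_eqF.
  by apply: le_trans; rewrite le_eqVlt; apply/orP; left; apply/eqP; ring.
have {}cV : c * `|V| <= `|D n k w|.
  by rewrite -(ger0_norm (ltW c0)) -normrM -ler_sqr ?nnegrE // !real_normK ?num_real.
rewrite U1E ler_pdivrMr // mulrAC ler_pdivlMr; last exact: mulr_gt0.
by rewrite mulrCA mulrA ler_pM2r // mulrC.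
Qed.

Lemma tau_nonincreasing k m n : (k.+2 <= m <= n)%N -> tau R n k <= tau R m k.
Proof.
move=> /andP[km /subnK <-]; elim: (n - m)%N => [|j IH]; first by rewrite add0n.
by apply: le_trans IH; rewrite addSn tau_next_le // (leq_trans km) ?leq_addl.
Qed.

End Monotonicity.

(** * Explicit T_{j+k}^(k) for j up to 6 *)

Section SmallCodegree.
Context {R : realType}.
Implicit Types (n k j : nat) (x r : R).

Local Notation T := (cheb R).
Local Notation D n k x := ((T n)^`(k)).[x].

Lemma cheb_derivn_diagE k x : D k k x = D k k 0.
Proof. by have [c _ ->] := @cheb_derivn_diag_gt0 R k; rewrite !hornerC. Qed.

(** The leading coefficient doubles with each degree except from T_0 to T_1, whence [0 < k]. *)
Lemma cheb_derivn_diagS k : (0 < k)%N -> D k.+1 k.+1 0 = 2 * k.+1%:R * D k k 0.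
Proof.
move=> k0; have kR : k%:R != 0 :> R by rewrite pnatr_eq0 -lt0n.
apply: (mulfI kR); rewrite cheb_derivn_upE cheb_derivn_gt_diag hornerC; ring.
Qed.

(** The lowering relation solved for the undifferentiated term: codegree j + 1 at order k comes from
    codegrees j and j - 1 at order k + 1. *)
Lemma cheb_derivn_codegree_rec j k x : (0 < j + k)%N ->
  D (j.+1 + k) k x = (x * D (j + k.+1) k.+1 x
     - (j.+1 + k)%:R / (j + k)%:R * D (j + k) k.+1 x) / j.+1%:R.
Proof.
move=> jk; have jkR : (j + k)%:R != 0 :> R by rewrite pnatr_eq0 -lt0n.
have jR : j.+1%:R != 0 :> R by rewrite pnatr_eq0.
rewrite addnS -addSn; have := cheb_derivn_downE (j + k) k x.
rewrite -addSn => E.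
have jkS : (j.+1 + k)%:R != 0 :> R by rewrite pnatr_eq0.
have -> : D (j + k) k.+1 x =
  (j + k)%:R * (x * D (j.+1 + k) k.+1 x - ((j.+1 + k)%:R - k%:R) * D (j.+1 + k) k x)
    / (j.+1 + k)%:R by rewrite -E mulrAC mulfV // mul1r.
by field; rewrite !nat1r -!natrD jkR jkS jR.
Qed.

(** Up to normalisation, this and the following formulas are the Gegenbauer polynomials of parameter
    k, with the constant T_k^(k) factored out. *)
Lemma cheb_derivn_codegree1 k x : (0 < k)%N ->
  D (1 + k) k x = 2 * (k%:R + 1) * D k k 0 * x.
Proof.
move=> k0; rewrite cheb_derivn_codegree_rec // !add0n cheb_derivn_gt_diag hornerC.
by rewrite mulr0 subr0 divr1 cheb_derivn_diagE cheb_derivn_diagS //; ring.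
Qed.

Lemma cheb_derivn_codegree2 k x : (0 < k)%N ->
  D (2 + k) k x = (k%:R + 2) * D k k 0 * (2 * (k%:R + 1) * x ^+ 2 - 1).
Proof.
move=> k0; have kR : 0 < k%:R :> R by rewrite ltr0n.
rewrite cheb_derivn_codegree_rec // cheb_derivn_codegree1 //.
rewrite [(1 + k)%N]add1n [D k.+1 k.+1 x]cheb_derivn_diagE !cheb_derivn_diagS //.
by field; rewrite gt_eqF //; lra.
Qed.

Lemma cheb_derivn_codegree3 k x : (0 < k)%N ->
  D (3 + k) k x =
  2 / 3 * (k%:R + 1) * (k%:R + 3) * D k k 0 * x * (2 * (k%:R + 2) * x ^+ 2 - 3).
Proof.
move=> k0; have kR : 0 < k%:R :> R by rewrite ltr0n.
rewrite cheb_derivn_codegree_rec // cheb_derivn_codegree2 //.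
rewrite [(2 + k)%N](_ : _ = 1 + k.+1)%N ?add1n // -[k.+2]add1n cheb_derivn_codegree1 //.
rewrite !cheb_derivn_diagS //.
by field; rewrite gt_eqF //; lra.
Qed.

Lemma cheb_derivn_codegree4 k x : (0 < k)%N ->
  D (4 + k) k x = (k%:R + 1) * (k%:R + 4) / 6 * D k k 0 *
   (4 * (k%:R + 2) * (k%:R + 3) * x ^+ 4 - 12 * (k%:R + 2) * x ^+ 2 + 3).
Proof.
move=> k0; have kR : 0 < k%:R :> R by rewrite ltr0n.
rewrite cheb_derivn_codegree_rec // cheb_derivn_codegree3 //.
rewrite [(3 + k)%N](_ : _ = 2 + k.+1)%N ?addnS // cheb_derivn_codegree2 //.
rewrite !cheb_derivn_diagS //.
by field; rewrite gt_eqF //; lra.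
Qed.

Lemma cheb_derivn_codegree5 k x : (0 < k)%N ->
  D (5 + k) k x = (k%:R + 1) * (k%:R + 2) * (k%:R + 5) / 15 * D k k 0 * x *
   (4 * (k%:R + 3) * (k%:R + 4) * x ^+ 4 - 20 * (k%:R + 3) * x ^+ 2 + 15).
Proof.
move=> k0; have kR : 0 < k%:R :> R by rewrite ltr0n.
rewrite cheb_derivn_codegree_rec // cheb_derivn_codegree4 //.
rewrite [(4 + k)%N](_ : _ = 3 + k.+1)%N ?addnS // cheb_derivn_codegree3 //.
rewrite !cheb_derivn_diagS //.
by field; rewrite gt_eqF //; lra.
Qed.

Lemma cheb_derivn_codegree6 k x : (0 < k)%N ->
  D (6 + k) k x = (k%:R + 1) * (k%:R + 2) * (k%:R + 6) / 90 * D k k 0 *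
   (8 * (k%:R + 3) * (k%:R + 4) * (k%:R + 5) * x ^+ 6
    - 60 * (k%:R + 3) * (k%:R + 4) * x ^+ 4 + 90 * (k%:R + 3) * x ^+ 2 - 15).
Proof.
move=> k0; have kR : 0 < k%:R :> R by rewrite ltr0n.
rewrite cheb_derivn_codegree_rec // cheb_derivn_codegree5 //.
rewrite [(5 + k)%N](_ : _ = 4 + k.+1)%N ?addnS // cheb_derivn_codegree4 //.
rewrite !cheb_derivn_diagS //.
by field; rewrite gt_eqF //; lra.
Qed.

End SmallCodegree.

(** * Closed forms in r, their monotonicity and limits *)

Section ClosedForms.
Context {R : realType}.
Implicit Types (n k j : nat) (x r : R).

Local Notation T := (cheb R).
Local Notation D n k x := ((T n)^`(k)).[x].

Lemma cheb_derivn_diag0_gt0 k : 0 < D k k 0.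
Proof. by have [c c0 ->] := @cheb_derivn_diag_gt0 R k; rewrite hornerC. Qed.

Definition alpha_fun (r : R) : R := Num.sqrt ((3 + r) ^+ 3 / (8 * (2 + r) ^+ 2)).

Definition beta_fun (r : R) : R := 2 * (5 + r) ^+ 2 / (25 * (2 + r)).

Lemma sqrt_gt x y : 0 <= x -> x ^+ 2 < y -> x < Num.sqrt y.
Proof. by move=> x0 xy; rewrite -[x]ger0_norm // -sqrtr_sqr ltr_sqrt // (le_lt_trans _ xy) ?sqr_ge0. Qed.

Lemma sqrt_lt x y : 0 < x -> y < x ^+ 2 -> Num.sqrt y < x.
Proof. by move=> x0 xy; rewrite -[x]gtr0_norm // -sqrtr_sqr ltr_sqrt // exprn_gt0. Qed.

(** For k >= 1, 3/(k+3) lies in ]0, 3/4]. The resulting bounds keep the denominators nonzero once k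
    is eliminated in favour of r. *)
Lemma codegree5_param k : (0 < k)%N ->
  let r := Num.sqrt (6 - 3 / (k%:R + 3)) in
  [/\ 2 < r < 3, 21 / 4 <= r ^+ 2 < 6 & k%:R = 3 / (6 - r ^+ 2) - 3 :> R].
Proof.
move=> k0 r; have kR : 1 <= k%:R :> R by rewrite ler1n.
have h0 : 0 < 3 / (k%:R + 3) :> R by apply: divr_gt0; lra.
have h1 : 3 / (k%:R + 3) <= 3 / 4 :> R by rewrite ler_pdivrMr; lra.
have r2 : r ^+ 2 = 6 - 3 / (k%:R + 3) by rewrite sqr_sqrtr //; lra.
split.
- by apply/andP; split; [apply: sqrt_gt | apply: sqrt_lt]; lra.
- by rewrite r2; lra.
- by rewrite r2; field; rewrite gt_eqF //; lra.
Qed.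

Lemma codegree6_param k : (0 < k)%N ->
  let r := Num.sqrt (10 - 15 / (k%:R + 4)) in
  [/\ 2 < r < 4, 7 <= r ^+ 2 < 10 & k%:R = 15 / (10 - r ^+ 2) - 4 :> R].
Proof.
move=> k0 r; have kR : 1 <= k%:R :> R by rewrite ler1n.
have h0 : 0 < 15 / (k%:R + 4) :> R by apply: divr_gt0; lra.
have h1 : 15 / (k%:R + 4) <= 3 :> R by rewrite ler_pdivrMr; lra.
have r2 : r ^+ 2 = 10 - 15 / (k%:R + 4) by rewrite sqr_sqrtr //; lra.
split.
- by apply/andP; split; [apply: sqrt_gt | apply: sqrt_lt]; lra.
- by rewrite r2; lra.
- by rewrite r2; field; rewrite gt_eqF //; lra.
Qed.

Lemma tau_codegree5 k : (0 < k)%N ->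
  let r := Num.sqrt (6 - 3 / (k%:R + 3)) in
  tau R (k + 5) k = Num.sqrt ((3 + r) / (2 * (k%:R + 4)))
    * (4 * ((k%:R + 3) * r - 3)) / ((k%:R + 4) * (2 * k%:R + 1) * (2 * k%:R + 3)).
Proof.
move=> k0 r; have [/andP[r_gt2 r_lt] /andP[r2_ge r2] kE] := codegree5_param k k0; rewrite -/r in r_gt2 r_lt r2_ge r2 kE.
have kR : 1 <= k%:R :> R by rewrite ler1n.
(* T_{k+5}^(k+1) has codegree 4, hence is quadratic in x^2 with roots (3 - r)/(2(k+4)) and (3 +
   r)/(2(k+4)); z^2 is the larger one. *)
set z := Num.sqrt ((3 + r) / (2 * (k%:R + 4))).
have z2 : z ^+ 2 = (3 + r) / (2 * (k%:R + 4)).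
  by rewrite sqr_sqrtr // ltW // divr_gt0; lra.
have z0 : 0 <= z by apply: sqrtr_ge0.
have r6 : 6 - r ^+ 2 != 0 by rewrite gt_eqF; lra.
have critE x : D (k + 5) k.+1 x = (k%:R + 2) * (k%:R + 5) / 6 * D k.+1 k.+1 0 *
   ((k%:R + 3) / (k%:R + 4)) *
   ((2 * (k%:R + 4) * x ^+ 2 - 3 - r) * (2 * (k%:R + 4) * x ^+ 2 - 3 + r)).
  rewrite [(k + 5)%N](_ : _ = 4 + k.+1)%N; last by rewrite addnC !addSnnS.
  rewrite cheb_derivn_codegree4 // -[k.+1%:R]nat1r.
  (* In terms of r, k + 4 = (9 - r^2)/(6 - r^2). *)
  have r9 : 9 - r ^+ 2 != 0 by rewrite gt_eqF; lra.
  rewrite kE; field; rewrite r6 /=.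
  rewrite (_ : _ + _ = 9 - r ^+ 2) //; ring.
rewrite /tau (omegaE _ _ z); first last.
- move=> x zx; have x2 : z ^+ 2 < x ^+ 2 by rewrite ltr_pXn2r ?nnegrE //; lra.
  have x2' : 3 + r < 2 * (k%:R + 4) * x ^+ 2.
    by move: x2; rewrite z2 ltr_pdivrMr ?[x ^+ 2 * _]mulrC //; lra.
  rewrite critE !mulr_gt0 ?invr_gt0 ?cheb_derivn_diag0_gt0 //; lra.
- by rewrite critE z2; field; rewrite !gt_eqF //; lra.
have c0 := cheb_derivn_diag0_gt0 k.
rewrite addnC !cheb_derivn_codegree5 //.
set c := D k k 0 in c0 *.
have inner : 4 * (k%:R + 3) * (k%:R + 4) * z ^+ 4 - 20 * (k%:R + 3) * z ^+ 2 + 15 =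
    - (4 * ((k%:R + 3) * r - 3) / (k%:R + 4)).
  rewrite (exprM z 2 2) z2 kE.
  by field; rewrite r6 /= (_ : _ + _ = 9 - r ^+ 2) ?gt_eqF //; [lra | ring].
have outer : 4 * (k%:R + 3) * (k%:R + 4) * 1 ^+ 4 - 20 * (k%:R + 3) * 1 ^+ 2 + 15 =
    (2 * k%:R + 1) * (2 * k%:R + 3) :> R by rewrite !expr1n; ring.
rewrite inner outer mulrN normrN ger0_norm; last first.
  do ![apply: divr_ge0 | apply: mulr_ge0]; rewrite ?(ltW c0) //; try lra.
  by move: r_gt2 kR; clear; nra.
by field; rewrite !gt_eqF //; lra.
Qed.

Lemma alphaE k : (0 < k)%N ->
  alpha R k = alpha_fun (Num.sqrt (6 - 3 / (k%:R + 3))).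
Proof.
move=> k0; have := codegree5_param k k0; rewrite /alpha tau_codegree5 // /=.
set r := Num.sqrt (6 - _) => -[/andP[r_gt2 r_lt] /andP[r2_ge r2] kE].
have kR : 1 <= k%:R :> R by rewrite ler1n.
rewrite /alpha_fun.
set a := (X in X = _).
have a0 : 0 <= a.
  rewrite /a; do ![apply: divr_ge0 | apply: mulr_ge0]; rewrite ?sqrtr_ge0 //; try lra.
  nra.
(* Writing a as the root of its square leaves a rational identity in r. *)
rewrite -[a]ger0_norm // -sqrtr_sqr; congr Num.sqrt.
rewrite /a !exprMn !exprVn !exprMn !sqr_sqrtr; first last.
- by apply: divr_ge0; lra.
- by apply: divr_ge0; lra.
by rewrite kE; field; rewrite !gt_eqF //; lra.
Qed.

(** T_{k+6}^(k) is even, so only z^2 enters and, unlike in codegree 5, no outer square root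
    remains. *)
Lemma tau_codegree6 k : (0 < k)%N ->
  let r := Num.sqrt (10 - 15 / (k%:R + 4)) in
  tau R (k + 6) k = 30 * r ^+ 2 * (r - 2) / (5 - r) ^+ 2
     / ((2 * k%:R + 1) * (2 * k%:R + 3) * (2 * k%:R + 5)).
Proof.
move=> k0 r; have [/andP[r_gt2 r_lt] /andP[r2_ge r2] kE] := codegree6_param k k0; rewrite -/r in r_gt2 r_lt r2_ge r2 kE.
have kR : 1 <= k%:R :> R by rewrite ler1n.
(* T_{k+6}^(k+1) is x times a quadratic in x^2; z^2 is its larger root. Here k + 5 = (25 - r^2)/(10
   - r^2). *)
set z := Num.sqrt ((5 + r) / (2 * (k%:R + 5))).
have z2 : z ^+ 2 = (5 + r) / (2 * (k%:R + 5)).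
  by rewrite sqr_sqrtr // ltW // divr_gt0; lra.
have z0 : 0 <= z by apply: sqrtr_ge0.
have r10 : 10 - r ^+ 2 != 0 by rewrite gt_eqF; lra.
have r5 : 5 - r != 0 by rewrite gt_eqF //; lra.
have r25 : 25 - r ^+ 2 != 0 by rewrite gt_eqF //; lra.
have critE x : D (k + 6) k.+1 x = (k%:R + 2) * (k%:R + 3) * (k%:R + 6) / 15
   * D k.+1 k.+1 0 * ((k%:R + 4) / (k%:R + 5)) *
   (x * ((2 * (k%:R + 5) * x ^+ 2 - 5 - r) * (2 * (k%:R + 5) * x ^+ 2 - 5 + r))).
  rewrite [(k + 6)%N](_ : _ = 5 + k.+1)%N; last by rewrite addnC !addSnnS.
  rewrite cheb_derivn_codegree5 // -[k.+1%:R]nat1r.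
  rewrite kE; field; rewrite r10 /=.
  rewrite (_ : _ + _ = 25 - r ^+ 2) //; ring.
rewrite /tau (omegaE _ _ z); first last.
- move=> x zx; have x2 : z ^+ 2 < x ^+ 2 by rewrite ltr_pXn2r ?nnegrE //; lra.
  have x2' : 5 + r < 2 * (k%:R + 5) * x ^+ 2.
    by move: x2; rewrite z2 ltr_pdivrMr ?[x ^+ 2 * _]mulrC //; lra.
  rewrite critE !mulr_gt0 ?invr_gt0 ?cheb_derivn_diag0_gt0 //; lra.
- by rewrite critE z2; field; rewrite !gt_eqF //; lra.
have c0 := cheb_derivn_diag0_gt0 k.
rewrite addnC !cheb_derivn_codegree6 //.
set c := D k k 0 in c0 *.
have inner : 8 * (k%:R + 3) * (k%:R + 4) * (k%:R + 5) * z ^+ 6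
    - 60 * (k%:R + 3) * (k%:R + 4) * z ^+ 4 + 90 * (k%:R + 3) * z ^+ 2 - 15 =
    - (30 * r ^+ 2 * (r - 2) / (5 - r) ^+ 2).
  rewrite (exprM z 2 2) (exprM z 2 3) z2 kE.
  by field; rewrite r5 r10 /= (_ : _ + _ = 25 - r ^+ 2) ?gt_eqF //; [lra | ring].
have outer : 8 * (k%:R + 3) * (k%:R + 4) * (k%:R + 5) * 1 ^+ 6
    - 60 * (k%:R + 3) * (k%:R + 4) * 1 ^+ 4 + 90 * (k%:R + 3) * 1 ^+ 2 - 15 =
    (2 * k%:R + 1) * (2 * k%:R + 3) * (2 * k%:R + 5) :> R by rewrite !expr1n; ring.
rewrite inner outer mulrN normrN ger0_norm; last first.
  by do ![apply: divr_ge0 | apply: mulr_ge0 | apply: exprn_ge0]; rewrite ?(ltW c0) //; try lra;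
    by move: r_gt2 kR; clear; nra.
by field; rewrite r5 !gt_eqF //; lra.
Qed.

Lemma betaE k : (0 < k)%N ->
  beta R k = beta_fun (Num.sqrt (10 - 15 / (k%:R + 4))).
Proof.
move=> k0; have := codegree6_param k k0; rewrite /beta tau_codegree6 // /=.
set r := Num.sqrt (10 - _) => -[/andP[r_gt2 r_lt] /andP[r2_ge r2] kE].
rewrite /beta_fun kE.
by field; rewrite !gt_eqF //; lra.
Qed.

Lemma alpha_fun_lt r s : 0 < r -> r < s -> alpha_fun r < alpha_fun s.
Proof.
move=> r0 rs; rewrite /alpha_fun ltr_sqrt; last first.
  by apply: divr_gt0; [apply: exprn_gt0 | apply: mulr_gt0 => //; apply: exprn_gt0]; lra.
rewrite ltr_pdivrMr; last by apply: mulr_gt0 => //; apply: exprn_gt0; lra.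
rewrite mulrAC ltr_pdivlMr; last by apply: mulr_gt0 => //; apply: exprn_gt0; lra.
pose u := 2 + r; pose v := 2 + s.
have u2 : 2 < u by rewrite /u; lra.
have uv : u < v by rewrite /u /v; lra.
rewrite -subr_gt0.
have -> : (3 + s) ^+ 3 * (8 * (2 + r) ^+ 2) - (3 + r) ^+ 3 * (8 * (2 + s) ^+ 2) =
  8 * (v - u) * ((u * v) ^+ 2 - 3 * (u * v) - (u + v)) by rewrite /u /v; ring.
(* The last factor then exceeds uv(uv - 4) > 0. *)
have uvs : u + v < u * v by nra.
have uv4 : 4 < u * v by nra.
by apply: mulr_gt0; [lra | nra].
Qed.

(** On r > -2 the quotient (5+r)^2/(2+r) is smallest at r = 1, hence the bound on r. *)
Lemma beta_fun_lt r s : 1 < r -> r < s -> beta_fun r < beta_fun s.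
Proof.
move=> r1 rs; rewrite /beta_fun ltr_pdivrMr; last lra.
rewrite mulrAC ltr_pdivlMr; last lra.
rewrite -subr_gt0.
have -> : 2 * (5 + s) ^+ 2 * (25 * (2 + r)) - 2 * (5 + r) ^+ 2 * (25 * (2 + s)) =
  50 * (s - r) * ((2 + r) * (2 + s) - 9) by ring.
by apply: mulr_gt0; [lra | nra].
Qed.

Lemma alpha_fun_sqrt6 : alpha_fun (Num.sqrt 6) = alpha_star R.
Proof.
have s2 : Num.sqrt 6 ^+ 2 = 6 :> R by rewrite sqr_sqrtr //; lra.
have s0 : 2 < Num.sqrt 6 :> R by apply: sqrt_gt; lra.
rewrite /alpha_fun /alpha_star; set s := Num.sqrt 6 in s2 s0 *.
have a0 : 0 <= Num.sqrt (3 * (3 + s)) / 4 by rewrite divr_ge0 ?sqrtr_ge0.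
rewrite -[RHS]ger0_norm // -sqrtr_sqr; congr Num.sqrt.
rewrite exprMn sqr_sqrtr; last lra.
(* Indeed 3 + s = (s/2)(2 + s) because s^2 = 6, so the denominator cancels. *)
have e : (3 + s) ^+ 2 = 3 / 2 * (2 + s) ^+ 2.
  by rewrite !sqrrD s2; field.
by rewrite exprSr e; field; rewrite gt_eqF //; lra.
Qed.

Lemma beta_fun_sqrt10 : beta_fun (Num.sqrt 10) = beta_star R.
Proof.
have s2 : Num.sqrt 10 ^+ 2 = 10 :> R by rewrite sqr_sqrtr //; lra.
have s0 : 3 < Num.sqrt 10 :> R by apply: sqrt_gt; lra.
rewrite /beta_fun /beta_star; set s := Num.sqrt 10 in s2 s0 *.
have -> : (5 + s) ^+ 2 = 5 / 2 * (2 + s) ^+ 2 by rewrite !sqrrD s2; field.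
by field; rewrite gt_eqF //; lra.
Qed.

Lemma cvg_sub_div_natr (a b : R) (m : nat) :
  (fun k : nat => a - b / (k.+1%:R + m%:R)) @ \oo --> a.
Proof.
rewrite -[X in _ --> X]subr0; apply: cvgB; first exact: cvg_cst.
rewrite -(mulr0 b); apply: cvgMr.
have -> : (fun k : nat => (k.+1%:R + m%:R)^-1) = (fun k => @harmonic R (k + m)).
  by apply/funext => k; rewrite -natrD addSn.
by rewrite cvg_shiftn; exact: cvg_harmonic.
Qed.

Lemma cvg_alpha : alpha R @ \oo --> alpha_star R.
Proof.
(* The shift keeps the limit and makes the index positive, as [alphaE] requires. *)
rewrite -cvg_shiftS; under eq_fun do rewrite alphaE //.
rewrite -alpha_fun_sqrt6 /alpha_fun.
have r_cvg : (fun k : nat => Num.sqrt (6 - 3 / (k.+1%:R + 3))) @ \oo --> (Num.sqrt 6 : R).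
  exact: (continuous_cvg _ (@sqrt_continuous R 6) (cvg_sub_div_natr 6 3 3)).
have s0 : 0 <= Num.sqrt 6 :> R by apply: sqrtr_ge0.
apply: (continuous_cvg _ (@sqrt_continuous R _)); apply: cvgM.
  exact: (continuous_cvg _ (@exprn_continuous R 3 _) (cvgD (cvg_cst _) r_cvg)).
apply: cvgV; first by rewrite gt_eqF // mulr_gt0 // exprn_gt0 //; lra.
apply: cvgMr; exact: (continuous_cvg _ (@exprn_continuous R 2 _) (cvgD (cvg_cst _) r_cvg)).
Qed.

Lemma cvg_beta : beta R @ \oo --> beta_star R.
Proof.
rewrite -cvg_shiftS; under eq_fun do rewrite betaE //.
rewrite -beta_fun_sqrt10 /beta_fun.
have r_cvg : (fun k : nat => Num.sqrt (10 - 15 / (k.+1%:R + 4))) @ \oo --> (Num.sqrt 10 : R).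
  exact: (continuous_cvg _ (@sqrt_continuous R 10) (cvg_sub_div_natr 10 15 4)).
have s0 : 0 <= Num.sqrt 10 :> R by apply: sqrtr_ge0.
apply: cvgM.
  apply: cvgMr.
  exact: (continuous_cvg _ (@exprn_continuous R 2 _) (cvgD (cvg_cst _) r_cvg)).
apply: cvgV; first by rewrite gt_eqF // mulr_gt0 //; lra.
by apply: cvgMr; apply: cvgD => //; apply: cvg_cst.
Qed.

End ClosedForms.

(** * Assembly, comparing r at k with r at k + 1 and with its limit *)

Theorem theorem1p3 (R : realType) :
  (forall k n : nat, (1 <= k)%N -> (k + 5 <= n)%N -> tau R n k <= tau R (k + 5) k) /\
  (forall k n : nat, (1 <= k)%N -> (k + 6 <= n)%N -> tau R n k <= tau R (k + 6) k) /\
  (forall k : nat, (1 <= k)%N -> alpha R k < alpha R k.+1) /\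
  (forall k : nat, (1 <= k)%N -> beta R k < beta R k.+1) /\
  (alpha R @ \oo --> alpha_star R) /\
  (beta R @ \oo --> beta_star R) /\
  (forall k : nat, (1 <= k)%N -> alpha R k < alpha_star R) /\
  (forall k : nat, (1 <= k)%N -> beta R k < beta_star R).
Proof.
have sqrtlt (x y : R) : x < y -> 0 < y -> Num.sqrt x < Num.sqrt y.
  by move=> xy y0; rewrite ltr_sqrt.
split; first by move=> k n _ kn; apply: tau_nonincreasing; rewrite kn andbT -addn2 leq_add2l.
split; first by move=> k n _ kn; apply: tau_nonincreasing; rewrite kn andbT -addn2 leq_add2l.
split.
  move=> k k1; rewrite !alphaE //.
  have [/andP[r0 _] _ _] := @codegree5_param R k k1.
  have kR : 1 <= k%:R :> R by rewrite ler1n.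
  apply: alpha_fun_lt; first lra.
  have h : 3 / (k.+1%:R + 3) < 3 / (k%:R + 3) :> R.
    by rewrite ltr_pM2l // ltf_pV2 ?posrE -?[k.+1%:R]nat1r; lra.
  have h1 : 3 / (k%:R + 3) < 1 :> R by rewrite ltr_pdivrMr; lra.
  by apply: sqrtlt; lra.
split.
  move=> k k1; rewrite !betaE //.
  have [/andP[r0 _] _ _] := @codegree6_param R k k1.
  have kR : 1 <= k%:R :> R by rewrite ler1n.
  apply: beta_fun_lt; first lra.
  have h : 15 / (k.+1%:R + 4) < 15 / (k%:R + 4) :> R.
    by rewrite ltr_pM2l // ltf_pV2 ?posrE -?[k.+1%:R]nat1r; lra.
  have h1 : 15 / (k%:R + 4) < 4 :> R by rewrite ltr_pdivrMr; lra.
  by apply: sqrtlt; lra.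
split; first exact: cvg_alpha.
split; first exact: cvg_beta.
split=> k k1.
  rewrite alphaE // -alpha_fun_sqrt6.
  have [/andP[r0 _] _ _] := @codegree5_param R k k1.
  apply: alpha_fun_lt; first lra.
  by apply: sqrtlt => //; rewrite ltrBlDr ltrDl divr_gt0 // -natrD ltr0n addn_gt0 k1.
rewrite betaE // -beta_fun_sqrt10.
have [/andP[r0 _] _ _] := @codegree6_param R k k1.
apply: beta_fun_lt; first lra.
by apply: sqrtlt => //; rewrite ltrBlDr ltrDl divr_gt0 // -natrD ltr0n addn_gt0 k1.
Qed.
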